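(* Let $l\in\mathbb{Z}_{\ge0}$. Let $P,F$ be polynomials in $d$ variables with coefficients in $\mathbb{C}$, let $x_0\in\mathbb{C}^d$ be a root of $P$, and let $\alpha\in\mathbb{Z}_{\ge0}^d$ be a multi-index defining a least order derivative with $D^\alpha P(x_0)\ne0$ (that is, $D^\alpha P(x_0)\neq0$ and $D^{\alpha'}P(x_0)=0$ whenever $|\alpha'|<|\alpha|$). Write $F(x)=[\widetilde{\mathcal{P}}_{\deg F}(x)]w$ with $w\in\mathbb{C}^{\tilde d(\deg F)}$. Let $l\ge\deg F+|\alpha|$, let $v\in\mathbb{C}^{\tilde d(l)}$ be a column vector and let $p=[\widetilde{\mathcal{P}}_l]v$ be the corresponding polynomial. Then $p$ is a solution of the PDE $$P(-iD)\left(e^{ix_0\cdot x}p(x)\right)=e^{ix_0\cdot x}F(x)$$ if and only if $v$ is a solution of the linear algebraic equation $$\left[\widetilde{\mathbf{D}}_lP(x_0)\right]v=\begin{bmatrix}w^T&0&\cdots&0\end{bmatrix}^T,$$ where the right-hand side is $w$ followed by $\tilde d(l)-\tilde d(\deg F)$ zeros.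
   Context: Here $d\in\mathbb{N}$ and $x\cdot y=x_1y_1+\cdots+x_dy_d$. For $k\in\mathbb{Z}_{\ge0}$, $\mathcal{A}_k$ is the list of all multi-indices $\alpha\in\mathbb{Z}_{\ge0}^d$ of length $|\alpha|=\alpha_1+\dots+\alpha_d=k$, ordered by a fixed lexicographical order. $\widetilde{\mathcal{A}}_l=(\mathcal{A}_0,\dots,\mathcal{A}_l)$ is the concatenated list, of length $\tilde d(l)=\frac{(d+l)!}{l!\,d!}$. $[\widetilde{\mathcal{P}}_l(x)]$ is the row vector of monomials $x^\alpha$, $\alpha$ running through $\widetilde{\mathcal{A}}_l$ in order. $\deg F$ is the total degree of $F$. Write $\beta\le\alpha$ if $\beta_s\le\alpha_s$ for all $s$; $\binom{\alpha}{\beta}=\prod_s\binom{\alpha_s}{\beta_s}$; $D^\gamma=D_1^{\gamma_1}\cdots D_d^{\gamma_d}$ with $D_n$ the partial derivative in the $n$th coordinate. $\widetilde{\mathbf{D}}_lP(x_0)$ is the $\tilde d(l)\times\tilde d(l)$ matrix with rows and columns indexed by $\widetilde{\mathcal{A}}_l$, whose entry in row $\beta$ and column $\alpha$ is $(-i)^{|\alpha-\beta|}\binom{\alpha}{\beta}D^{\alpha-\beta}P(x_0)$ if $\beta\le\alpha$, and $0$ otherwise. $P(-iD)$ is the constant coefficient differential operator obtained by substituting $-iD_n$ for the $n$th variable of $P$. *)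

(* Defs.v *)
From HB Require Import structures.
From mathcomp Require Import all_boot all_order all_algebra.
From mathcomp Require Import all_classical all_reals all_analysis.
From mathcomp Require Import complex.
(* The notations of mpoly clash with those of mathcomp-analysis. *)
From mathcomp Require Import -(notations) mpoly.
Import Order.TTheory GRing.Theory Num.Theory numFieldNormedType.Exports.

Set Implicit Arguments.
Unset Strict Implicit.
Unset Printing Implicit Defensive.

Local Open Scope ring_scope.

(* Restricted to multi-indices of equal length, the order [<=%O] of
   [multinom d] is the lexicographical order. *)
Definition multi_indices (d k : nat) : seq (multinom d) :=
  sort <=%O [seq bmnm m | m : bmultinom d k.+1 <- enum {: bmultinom d k.+1} & mdeg (bmnm m) == k].

Definition multi_indices_upto (d l : nat) : seq (multinom d) :=
  flatten [seq multi_indices d k | k <- iota 0 l.+1].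

Definition dtilde (d l : nat) : nat := ((d + l)`! %/ (l`! * d`!))%N.

Definition multi_index (d l : nat) (j : 'I_(dtilde d l)) : multinom d :=
  nth mnm0 (multi_indices_upto d l) j.

Lemma mem_multi_indices d k (m : multinom d) :
  (m \in multi_indices d k) = (mdeg m == k).
Proof.
rewrite mem_sort; apply/mapP/idP => [[b + ->] |/eqP mk].
  by rewrite mem_filter => /andP[].
have mlt : (mdeg m < k.+1)%N by rewrite mk.
by exists (BMultinom mlt) => //; rewrite mem_filter /= mk eqxx mem_enum.
Qed.

Lemma uniq_multi_indices d k : uniq (multi_indices d k).
Proof.
by rewrite sort_uniq (map_inj_uniq val_inj) filter_uniq ?enum_uniq.
Qed.

Lemma size_multi_indices d k : size (multi_indices d.+1 k) = 'C(k + d, k).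
Proof.
rewrite -size_basis; apply/perm_size/uniq_perm.
- exact: uniq_multi_indices.
- exact: uniq_basis.
- by move=> m; rewrite mem_multi_indices -basis_cover.
Qed.

Lemma size_multi_indices_upto d l : (0 < d)%N ->
  size (multi_indices_upto d l) = dtilde d l.
Proof.
case: d => // d _.
have -> : dtilde d.+1 l = 'C(d.+1 + l, l).
  by rewrite /dtilde -(@bin_fact (d.+1 + l) l) ?leq_addl // addnK mulnK //
             muln_gt0 !fact_gt0.
rewrite /multi_indices_upto; elim: l => [|l IH].
  by rewrite /= cats0 size_multi_indices !bin0.
rewrite -[X in iota 0 X]addn1 iotaD map_cat flatten_cat size_cat IH /= cats0.
by rewrite size_multi_indices !addnS !addSn binS addnC (addnC d l).
Qed.

Lemma mem_multi_indices_upto d l (m : multinom d) :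
  (m \in multi_indices_upto d l) = (mdeg m <= l)%N.
Proof.
apply/flatten_mapP/idP => [[k]|ml].
  by rewrite mem_iota add0n ltnS mem_multi_indices => kl /eqP ->.
by exists (mdeg m); rewrite ?mem_multi_indices // mem_iota add0n ltnS.
Qed.

(* The total degree, with the convention that the zero polynomial has
   degree 0. *)
Definition total_degree (d : nat) (C : nzRingType) (p : mpoly d C) : nat :=
  (mmeasure mdeg p).-1.

Section Monomials.
Variables (d : nat) (C : comNzRingType).

Definition monomials (l : nat) : 'rV[mpoly d C]_(dtilde d l) :=
  \row_j mpolyX C (multi_index j).

Definition poly_of_col (l : nat) (v : 'cV[C]_(dtilde d l)) : mpoly d C :=
  (monomials l *m map_mx (@mpolyC d C) v) 0 0.

End Monomials.

Definition zero_extend (C : nmodType) (m n : nat) (w : 'cV[C]_m) : 'cV[C]_n :=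
  \col_(i < n) oapp (fun j : 'I_m => w j 0) 0 (insub (val i)).

Section PDE.
Variables (R : realType) (d : nat).
Local Notation C := R[i].

Definition expC (z : C) : C :=
  (expR (complex.Re z))%:C%C *
  (cos (complex.Im z) +i* sin (complex.Im z))%C.

Definition dotC (x y : 'rV[C]_d) : C := \sum_(k < d) x 0 k * y 0 k.

Definition complex_vec (x : 'rV[R]_d) : 'rV[C]_d :=
  map_mx (real_complex R) x.

(* [R[i]] carries no structure of normed module over [R] in the libraries, so
   complex-valued functions are differentiated componentwise. *)
Definition partialC (k : 'I_d) (f : 'rV[R]_d -> C) : 'rV[R]_d -> C :=
  fun x => ('D_(delta_mx 0 k) (fun y => complex.Re (f y)) x +i*
            'D_(delta_mx 0 k) (fun y => complex.Im (f y)) x)%C.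

Definition miD (k : 'I_d) (f : 'rV[R]_d -> C) : 'rV[R]_d -> C :=
  fun x => - 'i%C * partialC k f x.

Definition miD_monomial (m : multinom d) (f : 'rV[R]_d -> C) :
    'rV[R]_d -> C :=
  foldr (fun k : 'I_d => iter (m k) (miD k)) f (enum 'I_d).

Definition P_miD (P : mpoly d C) (f : 'rV[R]_d -> C) : 'rV[R]_d -> C :=
  fun x => \sum_(m <- msupp P) mcoeff m P * miD_monomial m f x.

Definition evalC (p : mpoly d C) (x : 'rV[C]_d) : C := meval (x 0) p.

Definition Dmat (l : nat) (P : mpoly d C) (x0 : 'rV[C]_d) :
    'M[C]_(dtilde d l) :=
  \matrix_(i, j)
    let b := multi_index i in
    let a := multi_index j in
    if lem b a then
      (- 'i%C) ^+ mdeg (mnm_sub a b) * (\prod_(s < d) 'C(a s, b s))%N%:R *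
      evalC (mderivm (mnm_sub a b) P) x0
    else 0.

End PDE.

(* Main.v *)
Require Import Defs.
From HB Require Import structures.
From mathcomp Require Import all_boot all_order all_algebra.
From mathcomp Require Import all_classical all_reals all_analysis.
From mathcomp Require Import complex ring.
From mathcomp Require Import -(notations) mpoly.
Import Order.TTheory GRing.Theory Num.Theory numFieldNormedType.Exports.

Set Implicit Arguments.
Unset Strict Implicit.
Unset Printing Implicit Defensive.

Local Open Scope ring_scope.

(** Write e for the wave y |-> exp (i x0 . y).  Since -i D_k e = x0_k e, the
    product rule gives, for a polynomial p,

      -i D_k (e p) = e ((x0_k - i D_k) p),

    and therefore P(-iD) (e p) = e (P(x0 - iD) p).  Here P(x0 - iD) p is again
    a polynomial: it is [shifted_op (- 'i) x0 P p] below.  As e vanishes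
    nowhere and a complex polynomial is determined by its values at the real
    points ([evalC_eq0]), the PDE is the equality of polynomials
    P(x0 - iD) p = F ([P_miD_wave_eq]).

    It remains to compare coefficients.  By the Taylor expansion

      P(x0 - iD) = \sum_g D^g P(x0) / g! (-iD)^g,

    the coefficient of x^b in P(x0 - iD) x^a is the entry (b, a) of the matrix
    of the theorem ([mcoeff_shifted_opX]).  This is proved without the
    expansion: if the coefficients of a polynomial q are the entries, in a fixed
    column a, of the matrix of a symbol Q, then those of (x0_k - i D_k) q are
    the entries for the symbol X_k Q.  This is the Leibniz rule for
    D^g (X_k Q) together with the identity
    (b_k + 1) binom(a, b + u_k) = (a_k - b_k) binom(a, b), where u_k is the
    multi-index of X_k.
    Applying the factors x0_k - i D_k one at a time to x^a, whose coefficients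
    are the entries for Q = 1, covers the case where P is a monomial, and
    linearity covers the general case.

    So the linear system states that P(x0 - iD) p and F have the same
    coefficients at all multi-indices of length at most l; for those of larger
    length both coefficients are 0. *)

(** * Enumeration of the multi-indices *)

Section MultiIndexLists.
Variable d : nat.

Lemma multi_indices_upto_cat k l : (k <= l)%N ->
  exists s, multi_indices_upto d l = multi_indices_upto d k ++ s.
Proof.
move=> kl; exists (flatten [seq multi_indices d i | i <- iota k.+1 (l - k)]).
by rewrite -flatten_cat -map_cat -iotaD addSn subnKC.
Qed.

Lemma uniq_multi_indices_upto l : uniq (multi_indices_upto d l).
Proof.
rewrite /multi_indices_upto; elim: l => [|l IH].
  by rewrite /= cats0 uniq_multi_indices.
rewrite -addn1 iotaD map_cat flatten_cat cat_uniq IH /= cats0.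
rewrite uniq_multi_indices andbT; apply/hasPn => m.
rewrite mem_multi_indices => /eqP mE.
by rewrite [X in ~~ X]mem_multi_indices_upto mE -ltnNge.
Qed.

Hypothesis hd : (0 < d)%N.

Lemma multi_index_inj l : injective (@multi_index d l).
Proof.
move=> i j /eqP; rewrite /multi_index nth_uniq ?uniq_multi_indices_upto //;
  by [move/eqP/val_inj | rewrite size_multi_indices_upto].
Qed.

Lemma mdeg_multi_index l (j : 'I_(dtilde d l)) : (mdeg (multi_index j) <= l)%N.
Proof.
by rewrite -mem_multi_indices_upto mem_nth // size_multi_indices_upto.
Qed.

Lemma multi_index_surj l (m : multinom d) : (mdeg m <= l)%N ->
  exists j : 'I_(dtilde d l), multi_index j = m.
Proof.
rewrite -mem_multi_indices_upto => ml.
have jlt : (index m (multi_indices_upto d l) < dtilde d l)%N.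
  by rewrite -size_multi_indices_upto // index_mem.
by exists (Ordinal jlt); exact: nth_index.
Qed.

Lemma multi_index_prefix k l (i : 'I_(dtilde d l)) (j : 'I_(dtilde d k)) :
  (k <= l)%N -> val i = val j -> multi_index i = multi_index j.
Proof.
move=> /multi_indices_upto_cat [s sE] ij.
by rewrite /multi_index sE nth_cat size_multi_indices_upto // ij ltn_ord.
Qed.

Lemma mdeg_multi_index_gt k l (i : 'I_(dtilde d l)) :
  (k <= l)%N -> (dtilde d k <= i)%N -> (k < mdeg (multi_index i))%N.
Proof.
move=> kl ki; rewrite ltnNge; apply/negP => /multi_index_surj [j jE].
have [s sE] := multi_indices_upto_cat kl.
have dkl : (dtilde d k <= dtilde d l)%N.
  by rewrite -!size_multi_indices_upto // sE size_cat leq_addr.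
have /multi_index_inj wij : multi_index (widen_ord dkl j) = multi_index i.
  by rewrite (@multi_index_prefix k l _ j).
by move: ki; rewrite -wij leqNgt /= ltn_ord.
Qed.

End MultiIndexLists.

(** * Polynomials given by columns of coefficients *)

Section Columns.
Variables (d : nat) (C : comNzRingType).
Hypothesis hd : (0 < d)%N.

Lemma poly_of_colE l (v : 'cV[C]_(dtilde d l)) :
  poly_of_col v = \sum_j v j 0 *: mpolyX C (multi_index j).
Proof.
rewrite /poly_of_col mxE; apply: eq_bigr => j _.
by rewrite !mxE mulrC mul_mpolyC.
Qed.

Lemma mcoeff_poly_of_col l (v : 'cV[C]_(dtilde d l)) j :
  mcoeff (multi_index j) (poly_of_col v) = v j 0.
Proof.
rewrite poly_of_colE linear_sum (bigD1 j) //= mcoeffZ mcoeffX eqxx mulr1.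
rewrite big1 ?addr0 // => i ij; rewrite mcoeffZ mcoeffX.
by rewrite (inj_eq (@multi_index_inj d hd l)) (negbTE ij) mulr0.
Qed.

Lemma mcoeff_poly_of_col_gt l (v : 'cV[C]_(dtilde d l)) m :
  (l < mdeg m)%N -> mcoeff m (poly_of_col v) = 0.
Proof.
move=> lm; rewrite poly_of_colE linear_sum big1 //= => i _.
rewrite mcoeffZ mcoeffX; case: eqP => [im|_]; last by rewrite mulr0.
by move: lm; rewrite -im ltnNge mdeg_multi_index.
Qed.

(** The list for length at most k is a prefix of the list for length at most l,
    so rewriting a column for the longer list only appends zeros. *)
Lemma mcoeff_poly_of_col_ext k l (w : 'cV[C]_(dtilde d k))
    (i : 'I_(dtilde d l)) : (k <= l)%N ->
  mcoeff (multi_index i) (poly_of_col w) = zero_extend (dtilde d l) w i 0.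
Proof.
move=> kl; rewrite mxE; case: insubP => [j _ ji | ] /=.
  by rewrite (multi_index_prefix hd kl (esym ji)) mcoeff_poly_of_col.
by rewrite -leqNgt => ki; rewrite mcoeff_poly_of_col_gt // mdeg_multi_index_gt.
Qed.

End Columns.

(** * A Leibniz rule *)

Section Leibniz.
Variables (d : nat) (C : comNzRingType).
Implicit Types (Q : mpoly d C) (m g : multinom d).

Lemma mnm_ind (T : multinom d -> Prop) :
  T mnm0 -> (forall i m, T m -> T (mnm_add m (mnm1 i))) -> forall m, T m.
Proof.
move=> T0 TS m; elim: {m}(mdeg m) {-2}m (erefl (mdeg m)) => [|n IH] m mE.
  by move/eqP: mE; rewrite mdeg_eq0 => /eqP ->.
have /existsP [i mi] : [exists i, m i != 0%N].
  apply: contra_eqT mE => /existsPn m0.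
  suff -> : m = mnm0 by rewrite mdeg0.
  by apply/mnmP => i; rewrite mnm0E; apply/eqP; rewrite -[_ == _]negbK m0.
have sm : mnm_add (mnm_sub m (mnm1 i)) (mnm1 i) = m.
  by rewrite submK // lep1mP.
rewrite -sm; apply: TS; apply: IH.
by move: mE; rewrite -{1}sm mdegD mdeg1 addn1 => -[].
Qed.

Lemma subm_diag m : mnm_sub m m = mnm0.
Proof. by apply/mnmP => i; rewrite mnmBE subnn mnm0E. Qed.

(** The second derivatives of a variable vanish, so only two terms of the
    Leibniz expansion remain. *)
Lemma mderivmXM (k : 'I_d) g Q :
  mderivm g (mpolyX C (mnm1 k) * Q) =
  mpolyX C (mnm1 k) * mderivm g Q + (g k)%:R *: mderivm (mnm_sub g (mnm1 k)) Q.
Proof.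
elim/mnm_ind: g => [|j g IH].
  by rewrite mnm0E scale0r addr0 !mderivm0m.
rewrite !mderivmDm IH !mderivmU1m mderivD mderivM mderivZ mderivX mnm1E mnmDE mnm1E.
case: (altP (j =P k)) => [->|jk]; last first.
  rewrite eq_sym (negbTE jk) scale0r mul0r add0r addn0 -!mderivmU1m -!mderivmDm.
  congr (_ + _ *: mderivm _ _); apply/mnmP => i; rewrite !(mnmBE, mnmDE, mnm1E).
  by case: (altP (k =P i)) jk => [<- /negbTE ->|]; rewrite ?addn0 ?subn0.
rewrite eqxx scale1r addmK addn1 subm_diag mpolyX0 mul1r.
have -> : (g k)%:R *: mderiv k (mderivm (mnm_sub g (mnm1 k)) Q) =
          (g k)%:R *: mderivm g Q.
  case: (altP (g k =P 0%N)) => [-> | gk]; first by rewrite !scale0r.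
  by rewrite -mderivmU1m -mderivmDm submK // lep1mP.
by rewrite -natr1 scalerDl scale1r addrAC addrA addrC addrA addrAC.
Qed.

End Leibniz.

(** * The operator P(a + cD) on polynomials *)

Section ShiftedSymbol.
Variables (d : nat) (C : comNzRingType) (c : C) (a : 'I_d -> C).
Implicit Types (P Q p q : mpoly d C) (m g : multinom d).

Definition shifted_var (k : 'I_d) p : mpoly d C :=
  a k *: p + c *: mderiv k p.

(** The factors are applied in the order of the enumeration of the variables,
    the one in which [miD_monomial] applies the derivations. *)
Definition shifted_monomial m p : mpoly d C :=
  foldr (fun k => iter (m k) (shifted_var k)) p (enum 'I_d).

Definition shifted_op P p : mpoly d C :=
  \sum_(m <- msupp P) mcoeff m P *: shifted_monomial m p.

(** The coefficient at be of P(a + cD) x^al predicted by the Taylor expansion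
    of P at a; for c = -i these are the entries of [Dmat]. *)
Definition taylor_entry Q (be al : multinom d) : C :=
  if lem be al then
    c ^+ mdeg (mnm_sub al be) * (\prod_(s < d) 'C(al s, be s))%N%:R *
    meval a (mderivm (mnm_sub al be) Q)
  else 0.

Lemma prod_binS (k : 'I_d) (be al : multinom d) :
  ((be k).+1 * \prod_(s < d) 'C(al s, mnm_add be (mnm1 k) s) =
   (al k - be k) * \prod_(s < d) 'C(al s, be s))%N.
Proof.
rewrite (bigD1 k) //= [in RHS](bigD1 k) //= !mulnA mnmDE mnm1E eqxx addn1.
rewrite mul_bin_left; congr (_ * _)%N; apply: eq_bigr => s sk.
by rewrite mnmDE mnm1E eq_sym (negbTE sk) addn0.
Qed.

(** The recursion in the symbol that matches, coefficient by coefficient, the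
    operator a_k + c D_k: differentiating x^(be + u_k) in the variable k,
    where u_k is [mnm1 k], yields the factor be_k + 1. *)
Lemma taylor_entryXM (k : 'I_d) Q (be al : multinom d) :
  taylor_entry (mpolyX C (mnm1 k) * Q) be al =
  a k * taylor_entry Q be al +
  c * (taylor_entry Q (mnm_add be (mnm1 k)) al *+ (be k).+1).
Proof.
rewrite /taylor_entry; case: ifPn => [le|nle]; last first.
  rewrite ifN ?mul0rn ?mulr0 ?addr0 //; apply: contra nle.
  by apply: lepm_trans; exact: lem_addr.
rewrite mderivmXM mevalD mevalM mevalZ mevalXU mnmBE.
case: ifPn => [leS | nleS]; last first.
  (* Now be_k = al_k: the Leibniz term and the second entry both vanish. *)
  have -> : (al k - be k = 0)%N.
    apply/eqP; rewrite subn_eq0; apply: contraNleq nleS => lt.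
    apply/mnm_lepP => s; rewrite mnmDE mnm1E.
    case: eqP => [<-|_]; first by rewrite addn1.
    by rewrite addn0; move/mnm_lepP: le.
  by rewrite mul0r mul0rn mulr0 !addr0; ring.
have gE : mnm_sub al be = mnm_add (mnm_sub al (mnm_add be (mnm1 k))) (mnm1 k).
  rewrite -submDA submK // lep1mP mnmBE subn_eq0 -ltnNge.
  by move/mnm_lepP: leS => /(_ k); rewrite mnmDE mnm1E eqxx addn1.
rewrite submDA mulrDr; congr (_ + _); first by ring.
rewrite -mulr_natr.
rewrite {1}gE mdegD mdeg1 addn1 exprS.
have := congr1 (fun n => n%:R : C) (prod_binS k be al); rewrite !natrM => bE.
set X := meval a _; set D := c ^+ _.
transitivity (c * D * X *
  ((al k - be k)%:R * (\prod_(s < d) 'C(al s, be s))%N%:R)); first by ring.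
by rewrite -bE; ring.
Qed.

Lemma mcoeff_shifted_var (k : 'I_d) q Q al :
  (forall be, mcoeff be q = taylor_entry Q be al) ->
  forall be, mcoeff be (shifted_var k q) =
             taylor_entry (mpolyX C (mnm1 k) * Q) be al.
Proof.
move=> qQ be; rewrite /shifted_var mcoeffD !mcoeffZ mcoeff_deriv.
by rewrite !qQ taylor_entryXM.
Qed.

Lemma taylor_entry1 be al : taylor_entry 1 be al = (al == be)%:R.
Proof.
rewrite /taylor_entry; case: (altP (al =P be)) => [->|ne].
  rewrite lepm_refl subm_diag mdeg0 expr0 mul1r mderivm0m meval1 mulr1 big1 // => s _.
  by rewrite binn.
case: ifPn => // le; have : mnm_sub al be != mnm0.
  apply: contra ne => /eqP e.
  by rewrite -(submK le) e add0m.
elim/mnm_ind: (mnm_sub al be) => [|i g _ _]; first by rewrite eqxx.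
by rewrite addmC mderivmDm mderivmU1m mderivC linear0 meval0 mulr0.
Qed.

(** Each factor X_k of the symbol is matched with one application of
    a_k + c D_k, both products being taken in the order of the enumeration of
    the variables. *)
Lemma mcoeff_shifted_monomial m be al :
  mcoeff be (shifted_monomial m (mpolyX C al)) =
  taylor_entry (mpolyX C m) be al.
Proof.
rewrite (mpolyXE_id _ m) /shifted_monomial -big_enum /=.
elim: (enum 'I_d) be => [|k s IH] be /=.
  by rewrite big_nil taylor_entry1 mcoeffX.
rewrite big_cons; elim: (m k) be => [|n IHn] be /=; first by rewrite mul1r IH.
by rewrite exprS -mulrA; apply: mcoeff_shifted_var.
Qed.

Lemma mcoeff_shifted_opX P be al :
  mcoeff be (shifted_op P (mpolyX C al)) = taylor_entry P be al.
Proof.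
rewrite /shifted_op linear_sum /= [in RHS](mpolyE P) /taylor_entry; case: ifP => le.
  rewrite !linear_sum mulr_sumr; apply: eq_bigr => m _ /=.
  rewrite mcoeffZ mcoeff_shifted_monomial /taylor_entry le mderivmZ mevalZ.
  by rewrite mulrCA.
rewrite big1 // => m _.
by rewrite mcoeffZ mcoeff_shifted_monomial /taylor_entry le mulr0.
Qed.

Lemma shifted_var_is_linear k : linear (shifted_var k).
Proof.
move=> b p q; rewrite /shifted_var mderivD mderivZ !scalerDr !scalerA.
by rewrite !(mulrC _ b) addrACA.
Qed.

Lemma shifted_monomial_is_linear m : linear (shifted_monomial m).
Proof.
move=> b p q; rewrite /shifted_monomial; elim: (enum _) => //= k s IH.
by elim: (m k) => //= n ->; rewrite shifted_var_is_linear.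
Qed.

Lemma shifted_op_is_linear P : linear (shifted_op P).
Proof.
move=> b p q; rewrite /shifted_op scaler_sumr -big_split /=.
apply: eq_bigr => m _; rewrite shifted_monomial_is_linear scalerDr !scalerA.
by rewrite (mulrC b).
Qed.

HB.instance Definition _ P :=
  GRing.isLinear.Build C (mpoly d C) (mpoly d C) _ (shifted_op P)
    (shifted_op_is_linear P).

Lemma mcoeff_shifted_op_col P l (v : 'cV[C]_(dtilde d l)) be :
  mcoeff be (shifted_op P (poly_of_col v)) =
  \sum_j taylor_entry P be (multi_index j) * v j 0.
Proof.
rewrite poly_of_colE [shifted_op _ _]linear_sum linear_sum /=; apply: eq_bigr => j _.
by rewrite linearZ /= mcoeffZ mcoeff_shifted_opX mulrC.
Qed.

End ShiftedSymbol.

(** * Directional derivatives of composites *)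

Section ChainRule.
Variables (R : realType) (V : normedModType R).

(** Reduces the chain rule for directional derivatives to that for functions of
    one real variable. *)
Lemma is_derive_line (f : V -> R) (x v : V) (l : R) :
  is_derive x v f l <-> is_derive (0 : R) 1 (fun t : R => f (t *: v + x)) l.
Proof.
have E : (fun h : R => h^-1 *: (((fun t => f (t *: v + x)) \o shift 0) (h *: 1) -
           f (0 *: v + x))) =
         (fun h : R => h^-1 *: ((f \o shift x) (h *: v) - f x)).
  by apply: funext => h /=; rewrite scale0r add0r addr0 /GRing.scale /= mulr1.
by split=> -[dv vl]; apply: DeriveDef; rewrite /derivable /derive ?E // -?E.
Qed.

Lemma is_derive_comp1 (f : R -> R) (g : V -> R) (x v : V) (a b : R) :
  is_derive (g x) (1 : R) f a -> is_derive x v g b -> is_derive x v (f \o g) (a * b).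
Proof.
move=> fa /is_derive_line gb; apply/is_derive_line.
apply: (@is_derive1_comp _ f (fun t => g (t *: v + x))) => //.
by rewrite scale0r add0r.
Qed.

End ChainRule.

(** * Partial derivatives of complex-valued functions *)

Section ComplexDerivative.
Variables (R : realType) (d : nat).
Local Notation C := R[i].
Implicit Types (f g : 'rV[R]_d -> C) (x : 'rV[R]_d) (k : 'I_d).

(** [partialC] is total and obeys the rules of calculus only where the
    derivatives exist; this relation carries existence along with the value. *)
Definition is_partialC k f x (l : C) : Prop :=
  is_derive x (delta_mx 0 k) (fun y => complex.Re (f y)) (complex.Re l) /\
  is_derive x (delta_mx 0 k) (fun y => complex.Im (f y)) (complex.Im l).

Lemma partialCE k f x l : is_partialC k f x l -> partialC k f x = l.
Proof.
by case: l => l1 l2 [/= re im]; rewrite /partialC !derive_val.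
Qed.

Lemma is_partialC_cst k c x : is_partialC k (fun _ => c) x 0.
Proof. by split; exact: is_derive_cst. Qed.

Lemma is_partialCD k f g x l m :
  is_partialC k f x l -> is_partialC k g x m ->
  is_partialC k (fun y => f y + g y) x (l + m).
Proof.
move=> [fr fi] [gr gi]; split.
  have -> : (fun y => complex.Re (f y + g y)) =
            (fun y => complex.Re (f y)) + (fun y => complex.Re (g y)).
    by apply: funext => y; rewrite !fctE; case: (f y) (g y) => [? ?] [? ?].
  by apply: is_derive_eq; case: l m {fr fi gr gi} => [? ?] [? ?].
have -> : (fun y => complex.Im (f y + g y)) =
          (fun y => complex.Im (f y)) + (fun y => complex.Im (g y)).
  by apply: funext => y; rewrite !fctE; case: (f y) (g y) => [? ?] [? ?].
by apply: is_derive_eq; case: l m {fr fi gr gi} => [? ?] [? ?].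
Qed.

Lemma is_partialCM k f g x l m :
  is_partialC k f x l -> is_partialC k g x m ->
  is_partialC k (fun y => f y * g y) x (l * g x + f x * m).
Proof.
move=> [fr fi] [gr gi]; split.
  have -> : (fun y => complex.Re (f y * g y)) =
            (fun y => complex.Re (f y)) * (fun y => complex.Re (g y)) -
            (fun y => complex.Im (f y)) * (fun y => complex.Im (g y)).
    by apply: funext => y; rewrite !fctE; case: (f y) (g y) => [? ?] [? ?].
  apply: is_derive_eq; rewrite /GRing.scale /=.
  case: l m (f x) (g x) {fr fi gr gi} => [? ?] [? ?] [? ?] [? ?] /=; ring.
have -> : (fun y => complex.Im (f y * g y)) =
          (fun y => complex.Re (f y)) * (fun y => complex.Im (g y)) +
          (fun y => complex.Im (f y)) * (fun y => complex.Re (g y)).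
  by apply: funext => y; rewrite !fctE; case: (f y) (g y) => [? ?] [? ?].
apply: is_derive_eq; rewrite /GRing.scale /=.
case: l m (f x) (g x) {fr fi gr gi} => [? ?] [? ?] [? ?] [? ?] /=; ring.
Qed.

Lemma is_partialC_exp k f x l :
  is_partialC k f x l ->
  is_partialC k (fun y => expC (f y)) x (l * expC (f x)).
Proof.
move=> [fr fi].
have er := is_derive_comp1 (is_derive_expR _) fr.
have ec := is_derive_comp1 (is_derive_cos _) fi.
have es := is_derive_comp1 (is_derive_sin _) fi.
split.
  have -> : (fun y => complex.Re (expC (f y))) =
            (expR \o (fun y => complex.Re (f y))) *
            (cos \o (fun y => complex.Im (f y))).
    by apply: funext => y; rewrite /expC !fctE /= mul0r subr0.
  apply: is_derive_eq; rewrite /GRing.scale /= /expC.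
  case: l (f x) {fr fi er ec es} => [? ?] [? ?] /=; ring.
have -> : (fun y => complex.Im (expC (f y))) =
          (expR \o (fun y => complex.Re (f y))) *
          (sin \o (fun y => complex.Im (f y))).
  by apply: funext => y; rewrite /expC !fctE /= mul0r addr0.
apply: is_derive_eq; rewrite /GRing.scale /= /expC.
case: l (f x) {fr fi er ec es} => [? ?] [? ?] /=; ring.
Qed.

Lemma is_partialC_coord k (i : 'I_d) x :
  is_partialC k (fun y => complex_vec y 0 i) x (k == i)%:R.
Proof.
have -> : (k == i)%:R = ((k == i)%:R : R)%:C%C :> C by rewrite rmorph_nat.
split; last first.
  rewrite (_ : (fun y => _) = cst 0); first exact: is_derive_cst.
  by apply: funext => y; rewrite mxE.
rewrite (_ : (fun y => _) = (fun y : 'rV[R]_d => y 0 i)); last first.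
  by apply: funext => y; rewrite mxE.
apply/is_derive_line.
rewrite (_ : (fun t => _) = (k == i)%:R \*: id + cst (x 0 i)).
  by apply: is_derive_eq; rewrite /GRing.scale /= mulr1 addr0.
apply: funext => t; rewrite !fctE !mxE eqxx /= mulrC eq_sym.
by [].
Qed.

Lemma is_partialC_sum (I : Type) (r : seq I) k (F : I -> 'rV[R]_d -> C) x
    (L : I -> C) : (forall i, is_partialC k (F i) x (L i)) ->
  is_partialC k (fun y => \sum_(i <- r) F i y) x (\sum_(i <- r) L i).
Proof.
move=> FL; elim: r => [|i r IH].
  under eq_fun do rewrite big_nil.
  by rewrite big_nil; exact: is_partialC_cst.
under eq_fun do rewrite big_cons.
by rewrite big_cons; exact: is_partialCD.
Qed.

Lemma is_partialC_poly k (p : mpoly d C) x :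
  is_partialC k (fun y => evalC p (complex_vec y)) x
    (evalC (mderiv k p) (complex_vec x)).
Proof.
pose H q := forall x, is_partialC k (fun y => meval (complex_vec y 0) q) x
                        (meval (complex_vec x 0) (mderiv k q)).
have HC c : H (mpolyC d c).
  move=> z; rewrite mderivC meval0; under eq_fun do rewrite mevalC.
  exact: is_partialC_cst.
have HM q r : H q -> H r -> H (q * r).
  move=> Hq Hr z; rewrite mderivM mevalD !mevalM.
  by under eq_fun do rewrite mevalM; exact: is_partialCM.
have HX i : H (mpolyX C (mnm1 i)).
  move=> z; under eq_fun do rewrite mevalXU.
  rewrite mderivX mnm1E mevalZ.
  rewrite [X in is_partialC _ _ _ X](_ : _ = (k == i)%:R).
    exact: is_partialC_coord.
  rewrite eq_sym; case: eqP => [->|_]; last by rewrite mul0r.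
  by rewrite subm_diag mpolyX0 meval1 mulr1.
have H1 : H 1 by exact: HC.
have HXm m : H (mpolyX C m).
  rewrite mpolyXE_id; apply: (big_ind H) => // i _.
  by elim: (m i) => [|n IH]; rewrite ?expr0 // exprS; exact: HM.
have {}HX c m : H (c *: mpolyX C m) by rewrite -mul_mpolyC; exact: HM.
suff : H p by [].
elim/mpolyind: p => [|c m p _ _ Hp]; first exact: HC.
move=> z; rewrite mderivD mevalD; under eq_fun do rewrite mevalD.
by apply: is_partialCD; [exact: HX | exact: Hp].
Qed.

Variable x0 : 'rV[C]_d.
Local Notation wave := (fun y => expC ('i%C * dotC x0 (complex_vec y))).

Lemma is_partialC_wave k x :
  is_partialC k wave x ('i%C * x0 0 k * wave x).
Proof.
apply: is_partialC_exp.
have -> : 'i%C * x0 0 k = 0 * dotC x0 (complex_vec x) +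
    'i%C * \sum_i (0 * complex_vec x 0 i + x0 0 i * (k == i)%:R).
  rewrite mul0r add0r (bigD1 k) //= eqxx mul0r add0r mulr1 big1 ?addr0 // => i.
  by rewrite eq_sym => /negbTE ->; rewrite mul0r mulr0 addr0.
apply: is_partialCM; first exact: is_partialC_cst.
apply: is_partialC_sum => i; apply: is_partialCM; first exact: is_partialC_cst.
exact: is_partialC_coord.
Qed.

End ComplexDerivative.

(** * Values of complex polynomials at real points *)

Section RealPoints.
Variables (R : realType) (d : nat).
Local Notation C := R[i].
Implicit Types (p q : mpoly d C).

Lemma meval0_mcoeff p : meval (fun _ => 0) p = mcoeff mnm0 p.
Proof.
elim/mpolyind: p => [|c m p _ _ IH]; first by rewrite meval0 mcoeff0.
rewrite mevalD mevalZ mcoeffD mcoeffZ IH mcoeffX mevalX; congr (_ * _ + _).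
case: (altP (m =P mnm0)) => [->|]; first by rewrite big1 // => i _; rewrite mnm0E.
elim/mnm_ind: m => [|i m _ _]; first by rewrite eqxx.
by rewrite (bigD1 i) //= mnmDE mnm1E eqxx addn1 exprS !mul0r.
Qed.

(** The partial derivatives of p at real points are those of the zero function,
    so every D^m p vanishes at the origin, where its value is m! times the
    coefficient of x^m in p. *)
Lemma evalC_eq0 p :
  (forall x : 'rV[R]_d, evalC p (complex_vec x) = 0) -> p = 0.
Proof.
have Dk q k : (forall x : 'rV[R]_d, evalC q (complex_vec x) = 0) ->
    forall x : 'rV[R]_d, evalC (mderiv k q) (complex_vec x) = 0.
  move=> q0 x; rewrite -(partialCE (is_partialC_poly k q x)).
  under eq_fun do rewrite q0.
  exact/partialCE/is_partialC_cst.
move=> p0; have Dm m : forall x : 'rV[R]_d,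
    evalC (mderivm m p) (complex_vec x) = 0.
  elim/mnm_ind: m => [|i m IH]; first by rewrite mderivm0m.
  by rewrite mderivmDm mderivmU1m; exact: Dk.
apply/mpolyP => m; rewrite mcoeff0; have := Dm m 0.
rewrite /evalC (@meval_eq _ _ _ (fun _ => 0)); last first.
  by move=> i; rewrite !mxE.
rewrite meval0_mcoeff mcoeff_mderivm addm0 => /eqP.
rewrite mulrn_eq0 => /orP [|/eqP //].
by rewrite -leqn0 leqNgt prodn_gt0 // => i; rewrite ffactnn fact_gt0.
Qed.

End RealPoints.

(** * Constant coefficient operators on plane waves *)

Section Waves.
Variables (R : realType) (d : nat) (x0 : 'rV[R[i]]_d).
Local Notation C := R[i].
Local Notation wave := (fun y => expC ('i%C * dotC x0 (complex_vec y))).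
Local Notation var := (shifted_var (- 'i%C) (x0 0)).
Implicit Types (P p : mpoly d C).

(** The modulus of exp z is the exponential of the real part of z; here this
    appears as cos^2 + sin^2 = 1. *)
Lemma expC_neq0 (z : C) : expC z != 0.
Proof.
rewrite mulf_eq0 negb_or eq_complex /= eqxx andbT gt_eqF ?expR_gt0 //=.
rewrite eq_complex /=; apply/negP => /andP [/eqP c0 /eqP s0].
have := cos2Dsin2 (complex.Im z); rewrite c0 s0 expr0n addr0 => /eqP.
by rewrite eq_sym oner_eq0.
Qed.

(** The product rule, with -i D_k e = x0_k e for the wave e. *)
Lemma miD_wave k p :
  miD k (fun y => wave y * evalC p (complex_vec y)) =
  (fun y => wave y * evalC (var k p) (complex_vec y)).
Proof.
apply: funext => x; rewrite /miD.
rewrite (partialCE (is_partialCM (is_partialC_wave x0 k x)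
                                 (is_partialC_poly k p x))).
rewrite /evalC /shifted_var mevalD !mevalZ.
have ii : - 'i%C * 'i%C = 1 :> C by rewrite mulNr -expr2 sqr_i opprK.
move: (expC _) => W; rewrite !mulrDr !mulrA ii mul1r.
by rewrite [W * x0 0 k]mulrC [W * _]mulrC.
Qed.

Lemma miD_monomial_wave m p :
  miD_monomial m (fun y => wave y * evalC p (complex_vec y)) =
  (fun y => wave y *
            evalC (shifted_monomial (- 'i%C) (x0 0) m p) (complex_vec y)).
Proof.
rewrite /miD_monomial /shifted_monomial; elim: (enum _) => //= k s ->.
by elim: (m k) => //= n ->; rewrite miD_wave.
Qed.

Lemma P_miD_wave P p x :
  P_miD P (fun y => wave y * evalC p (complex_vec y)) x =
  wave x * evalC (shifted_op (- 'i%C) (x0 0) P p) (complex_vec x).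
Proof.
rewrite /P_miD /shifted_op /evalC linear_sum mulr_sumr /=.
apply: eq_bigr => m _; rewrite mevalZ.
by rewrite [miD_monomial _ _](miD_monomial_wave m p) mulrCA.
Qed.

(** For the direct implication, cancel the wave and use that a polynomial
    vanishing at all real points is 0. *)
Lemma P_miD_wave_eq P p F :
  (forall x : 'rV[R]_d,
     P_miD P (fun y => wave y * evalC p (complex_vec y)) x =
     wave x * evalC F (complex_vec x)) <->
  shifted_op (- 'i%C) (x0 0) P p = F.
Proof.
split=> [PDE | <- x]; last exact: P_miD_wave.
apply/eqP; rewrite -subr_eq0; apply/eqP/evalC_eq0 => x.
have := PDE x; rewrite P_miD_wave => /(mulfI (expC_neq0 _)).
by rewrite /evalC mevalB => ->; rewrite subrr.
Qed.

Lemma Dmat_mul l P (v : 'cV[C]_(dtilde d l)) i :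
  (Dmat l P x0 *m v) i 0 =
  mcoeff (multi_index i) (shifted_op (- 'i%C) (x0 0) P (poly_of_col v)).
Proof.
by rewrite mcoeff_shifted_op_col mxE; apply: eq_bigr => j _; rewrite mxE.
Qed.

End Waves.

Theorem theorem4p6 (R : realType) (d : nat) (hd : (0 < d)%N) (l : nat)
    (P F : mpoly d R[i]) (x0 : 'rV[R[i]]_d) (hroot : evalC P x0 = 0)
    (alpha : multinom d)
    (halpha : evalC (mderivm alpha P) x0 <> 0)
    (hleast : forall alpha' : multinom d, (mdeg alpha' < mdeg alpha)%N ->
      evalC (mderivm alpha' P) x0 = 0)
    (w : 'cV[R[i]]_(dtilde d (total_degree F)))
    (hF : F = poly_of_col w)
    (hl : (total_degree F + mdeg alpha <= l)%N)
    (v : 'cV[R[i]]_(dtilde d l))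
    (p : mpoly d R[i]) (hp : p = poly_of_col v) :
  (forall x : 'rV[R]_d,
     P_miD P
       (fun y => expC ('i%C * dotC x0 (complex_vec y)) *
                 evalC p (complex_vec y)) x
     = expC ('i%C * dotC x0 (complex_vec x)) * evalC F (complex_vec x))
  <-> Dmat l P x0 *m v = zero_extend (dtilde d l) w.
Proof.
rewrite P_miD_wave_eq hp.
have kl : (total_degree F <= l)%N by exact: leq_trans (leq_addr _ _) hl.
have FE (i : 'I_(dtilde d l)) :
    mcoeff (multi_index i) F = zero_extend (dtilde d l) w i 0.
  by rewrite {1}hF mcoeff_poly_of_col_ext.
split=> [opE | DvE]; first by apply/colP => i; rewrite Dmat_mul opE FE.
apply/mpolyP => m; case: (leqP (mdeg m) l) => [|ml].
  by move/(multi_index_surj hd) => [i <-]; rewrite -Dmat_mul DvE FE.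
rewrite {1}hF mcoeff_poly_of_col_gt ?(leq_ltn_trans kl) //.
rewrite mcoeff_shifted_op_col.
rewrite big1 // => j _; rewrite /taylor_entry ifN ?mul0r //.
apply: contraL ml => /lem_leo/lemc_mdeg mj; rewrite -leqNgt.
exact: leq_trans mj (mdeg_multi_index hd j).
Qed.
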